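(* Let $A, B \subseteq H$ be non-empty sets with a common point $\bar{x} \in A \cap B$. Assume that $A$ and $B$ are locally closed at $\bar{x}$ and intersect transversally at $\bar{x}$ with $\cos(A,B,\bar{x}) = \bar{c} < 1$, and that both $A$ and $B$ are super-regular at $\bar{x}$. For every $c \in (\bar{c}, 1)$ and every $\sigma_A, \sigma_B \in (1, \frac{1}{c})$ define $$\kappa_{A} = \frac{\sigma_A}{\sigma_B} \left[ c + \sqrt{1 - c^2} \sqrt{\sigma_B^2 - 1} \right], \qquad \kappa_{B} = \frac{\sigma_B}{\sigma_A} \left[ c + \sqrt{1 - c^2} \sqrt{\sigma_A^2 - 1} \right].$$ If $\kappa_{A} \cdot \kappa_{B} < 1$, then there exists $\delta > 0$ such that for every $a_0 \in A$ satisfying $$|a_0 - \bar{x}| < \frac{1 - \kappa_A \kappa_B}{2(\sigma_B + 1)[\sigma_B + 1 + \kappa_A(\sigma_B-\kappa_B)]}\, \delta,$$ the quasioptimal alternating projections started at $a_0$ with constants $\sigma_A$ and $\sigma_B$ converge to a point $\hat{x} \in A \cap B$ such that $|\hat{x} - \bar{x}| < \tfrac{3}{8} \delta$ and, for all $n \in \mathbb{N}_0$, $$|\hat{x} - a_n| \leq \frac{\sigma_B (1 + \kappa_{A})}{1 - \kappa_{A} \kappa_{B}} (\kappa_{A} \kappa_{B})^n \cdot \mathrm{dist}(a_0, B),$$ $$|\hat{x} - b_{n+1}| \leq \frac{\sigma_B(1 + \kappa_{B}) \kappa_{A}}{1 - \kappa_{A} \kappa_{B}} (\kappa_{A} \kappa_{B})^n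 \cdot \mathrm{dist}(a_0, B).$$
   Context: $H$ is a Euclidean space (finite-dimensional real inner product space) with inner product $\langle\cdot,\cdot\rangle$ and norm $|\cdot|$; $\mathbb{B}_r(x)$ is the open ball of radius $r$ centred at $x$, and $\overline{\mathbb{B}}$ is the closed unit ball at the origin. $\mathbb{N}_0=\{0,1,2,\dots\}$. A neighbourhood of a point is an open set containing it. For non-empty $A\subseteq H$ and $x\in H$: $\mathrm{dist}(x,A)=\inf_{a\in A}|x-a|$; the (optimal) metric projection is $\Pi_A(x)=\{a\in A: |x-a|=\mathrm{dist}(x,A)\}$; for $\sigma\ge 1$ the $\sigma$-quasioptimal metric projection is $\Pi_A(x;\sigma)=\{a\in A: |x-a|\le\sigma\cdot\mathrm{dist}(x,A)\}$ (so $\Pi_A(x;1)=\Pi_A(x)$). $A$ is locally closed at $\hat a\in A$ if there is a neighbourhood $\mathcal V$ of $\hat a$ such that $A\cap\mathcal V$ is closed in $\mathcal V$. Proximal normal cone at $\hat a\in A$: $N^{\mathrm{prox}}_A(\hat a)=\{v\in H: \hat a\in\Pi_A(\hat a+\tau v)\text{ for some }\tau>0\}$. If $A$ is locally closed at $\hat a$, the limiting normal cone $N^{\mathrm{lim}}_A(\hat a)$ is the set of all $v\in H$ for which there are $a_n\in A$ and $v_n\in N^{\mathrm{prox}}_A(a_n)$ with $a_n\to\hat a$, $v_n\to v$. A non-empty set $A$, locally closed at $\hat a\in A$, is super-regular at $\hat a$ if for every $\varepsilon>0$ there is $\delta>0$ such that $A\cap\mathbb{B}_\delta(\hat a)$ is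 closed in $\mathbb{B}_\delta(\hat a)$ and $\langle v,a'-a\rangle\le\varepsilon|v|\cdot|a'-a|$ for all $a,a'\in A\cap\mathbb{B}_\delta(\hat a)$ and $v\in N^{\mathrm{lim}}_A(a)$. Non-empty $A,B$, locally closed at $\bar x\in A\cap B$, intersect transversally at $\bar x$ if $-N^{\mathrm{lim}}_A(\bar x)\cap N^{\mathrm{lim}}_B(\bar x)=\{0\}$. Moreover, $\cos(A,B,\bar x)=\max\{\langle u,v\rangle: u\in -N^{\mathrm{lim}}_A(\bar x)\cap\overline{\mathbb B},\ v\in N^{\mathrm{lim}}_B(\bar x)\cap\overline{\mathbb B}\}\in[0,1]$; transversality at $\bar x$ is equivalent to $\cos(A,B,\bar x)<1$. Quasioptimal alternating projections (QAP) with constants $\sigma_A,\sigma_B\ge1$ started at $a_0\in A$: $b_{n+1}\in\Pi_B(a_n;\sigma_B)$, $a_{n+1}\in\Pi_A(b_{n+1};\sigma_A)$, $n\in\mathbb{N}_0$. ''The QAP converge to $\hat x$'' means: whatever choices of elements are made, the projections at each step are non-empty (the sequences are well-defined) and both $(a_n)$ and $(b_n)$ converge to $\hat x$ (which may depend on the choices). *)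

(* Defs.v *)
From HB Require Import structures.
From mathcomp Require Import all_boot all_order all_algebra.
From mathcomp Require Import sesquilinear.
From mathcomp Require Import all_classical all_reals all_analysis.
Set Implicit Arguments.
Unset Strict Implicit.
Unset Printing Implicit Defensive.
Import Order.TTheory GRing.Theory Num.Theory.
Import numFieldNormedType.Exports.
Local Open Scope classical_set_scope.
Local Open Scope ring_scope.

(* A finite-dimensional real inner product space.  [normv_dotE] says that the
   norm, and hence (by the [NormedModule] axioms) balls, open sets and limits,
   are those induced by the inner product. *)
HB.mixin Record isEuclidean (R : realType) (H : Type)
    of NormedModule R H & Vector R H := {
  dotv : {dot H for @idfun R} ;
  normv_dotE : forall x : H, `|x| = Num.sqrt (dotv x x)
}.

#[short(type="euclideanType")]
HB.structure Definition Euclidean (R : realType) :=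
  {H of NormedModule R H & Vector R H & isEuclidean R H}.

Section Definitions.
Variables (R : realType) (H : euclideanType R).
Implicit Types (A B V : set H) (x v : H) (a b : nat -> H).

(* Only meaningful for a non-empty [A]. *)
Definition dist x A : R := inf [set `|x - y| | y in A].

Definition proj A x : set H := [set y | A y /\ `|x - y| = dist x A].

Definition quasiproj A x (sigma : R) : set H :=
  [set y | A y /\ `|x - y| <= sigma * dist x A].

Definition closed_rel V A := closed (A `&` V : set (subspace V)).

Definition locally_closed A x := exists V, [/\ open V, V x & closed_rel V A].

Definition prox_normal A x : set H :=
  [set v | exists2 tau : R, 0 < tau & proj A (x + tau *: v) x].

(* Only used at points where [A] is locally closed. *)
Definition lim_normal A x : set H :=
  [set v | exists a w : nat -> H,
    [/\ forall n, A (a n) /\ prox_normal A (a n) (w n),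
        a @ \oo --> x & w @ \oo --> v]].

Definition super_regular A x := forall eps : R, 0 < eps ->
  exists delta : R, [/\ 0 < delta, closed_rel (ball x delta) A &
    forall y y' v, (A `&` ball x delta) y -> (A `&` ball x delta) y' ->
      lim_normal A y v -> dotv v (y' - y) <= eps * `|v| * `|y' - y|].

Definition intersect_transversally A B x :=
  [set - u | u in lim_normal A x] `&` lim_normal B x = [set 0].

(* The supremum is a maximum: the two truncated cones are compact and contain
   0, provided that [x] belongs to both sets. *)
Definition cos_angle A B x : R :=
  sup [set dotv u v | u in [set - u | u in lim_normal A x] `&`
                           [set u | `|u| <= 1]
                    & v in lim_normal B x `&` [set v | `|v| <= 1]].

Section QAP.
Variables (A B : set H) (sigmaA sigmaB : R) (a0 : H).

Definition qap_step a b n :=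
  quasiproj B (a n) sigmaB (b n.+1) /\ quasiproj A (b n.+1) sigmaA (a n.+1).

(* [b 0] plays no role. *)
Definition qap a b := a 0%N = a0 /\ forall n, qap_step a b n.

(* Whatever choices were made during the first [N] steps, both projections
   of the next step are non-empty. *)
Definition qap_well_defined := forall N a b,
  a 0%N = a0 -> (forall n, (n < N)%N -> qap_step a b n) ->
  quasiproj B (a N) sigmaB !=set0 /\
  forall y, quasiproj B (a N) sigmaB y -> quasiproj A y sigmaA !=set0.

End QAP.

End Definitions.

(* Main.v *)
Require Import Defs.
From mathcomp Require Import all_boot all_order all_algebra.
From mathcomp Require Import all_classical all_reals all_analysis.
From mathcomp Require Import ring lra.
Import Order.TTheory GRing.Theory Num.Theory.
Import numFieldNormedType.Exports.
Import passmx.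
Local Open Scope classical_set_scope.
Local Open Scope ring_scope.
Set Implicit Arguments.
Unset Strict Implicit.

(** The two distances dist(a_n, B) and dist(b_{n+1}, A) decrease geometrically,
    and everything else is summation of geometric series.

    The geometric core is one estimate for one half-step
    ([quasiproj_contract]).  Let [a] be in [A] near [xbar], [b] a
    sigma-quasiprojection of [a] on [B], [b'] an exact projection of [a] on [B]
    and [a'] an exact projection of [b] on [A]; put d = dist(a, B) and
    e = dist(b, A).  The vector [U = a - b'] is a proximal normal to [B] of
    length d, and [W = b - a'] a proximal normal to [A] of length e.  Consider
    the unit vectors u = U/d and w = -W/e, and v = (a - b)/(sigma d), of norm at
    most one.
    - Transversality persists near [xbar] ([cos_angle_near]): <u, w> <= c1 for
      any prescribed c1 between the limiting cosine and [c].
    - Super-regularity of [B] says that <U, b - b'> is almost nonpositive, so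
      <u, v> is at least 1/sigma, up to an O(eps) error.
    - Super-regularity of [A] says that <W, a - a'> is almost nonpositive, so
      e is at most sigma d <w, v>, up to an O(eps) error.
    As c1 < c < 1/sigma, the angle between [u] and [w] is larger than the angle
    between [u] and [v]; hence the angle between [w] and [v] is at least
    arccos c1 - arccos(1/sigma) ([dotv_le_cos_acosB]).  Passing from c1 to the
    strictly larger [c] absorbs the O(eps) errors ([cos_acosB_slack]), and so
    e <= sigma cos(arccos c - arccos(1/sigma)) d, where the factor equals
    c + sqrt(1 - c^2) sqrt(sigma^2 - 1) ([sigma_cos_acosBE]).

    Calling the two factors mB and mA, a full step multiplies dist(a_n, B) by at
    most q = mA mB = kappaA kappaB.  The radius allowed for the starting point
    is such that the sum of all the steps stays in the ball where the half-step
    estimate is valid, which is shown by induction ([qap_invariant]).  Closed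
    balls of [H] being compact, the sequence (a_n) has a cluster point, and the
    geometric bound on its tails makes the cluster point a limit
    ([qap_cvg]). *)

(** * Inner products and compact balls *)

Lemma le_of_eq (R : numDomainType) (x y : R) : x = y -> x <= y.
Proof. by move=> ->. Qed.

Section InnerProduct.
Context (R : realType) (H : euclideanType R).
Implicit Types u v w : H.

Lemma dotvC u v : dotv u v = dotv v u.
Proof. by have := hermC (@dotv R H) u v; rewrite expr0 mul1r. Qed.

Lemma dotvDl u v w : dotv (u + v) w = dotv u w + dotv v w.
Proof. exact: linearDl. Qed.

Lemma dotvDr u v w : dotv w (u + v) = dotv w u + dotv w v.
Proof. exact: linearDr. Qed.

Lemma dotvNl u v : dotv (- u) v = - dotv u v.
Proof. exact: linearNl. Qed.

Lemma dotvNr u v : dotv u (- v) = - dotv u v.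
Proof. exact: linearNr. Qed.

Lemma dotvZl a u v : dotv (a *: u) v = a * dotv u v.
Proof. exact: linearZl_LR. Qed.

Lemma dotvZr a u v : dotv u (a *: v) = a * dotv u v.
Proof. exact: linearZr_LR. Qed.

Definition dotvE := (dotvDl, dotvDr, dotvNl, dotvNr, dotvZl, dotvZr).

Lemma sqr_normv u : `|u| ^+ 2 = dotv u u.
Proof.
rewrite normv_dotE sqr_sqrtr//.
have [->|u0] := eqVneq u 0; last exact/ltW/neq0_dnorm_gt0.
by rewrite linear0r.
Qed.

(** The square of the norm of |v| u - |u| v is 2 |u| |v| (|u| |v| - <u, v>). *)
Lemma dotv_le_norm u v : dotv u v <= `|u| * `|v|.
Proof.
have [->|u0] := eqVneq u 0; first by rewrite linear0l normr0 mul0r.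
have [->|v0] := eqVneq v 0; first by rewrite linear0r normr0 mulr0.
have uv0 : 0 < `|u| * `|v| by rewrite mulr_gt0 ?normr_gt0.
have := sqr_ge0 `| `|v| *: u - `|u| *: v|.
rewrite sqr_normv !dotvE -!sqr_normv (dotvC v u) => h.
rewrite -(ler_pM2l uv0); nra.
Qed.

Lemma dotv_polar u v : dotv u v = (`|u + v| ^+ 2 - `|u - v| ^+ 2) / 4.
Proof. rewrite !sqr_normv !dotvE (dotvC v u); lra. Qed.

Lemma cvg_dotv (u v : nat -> H) (p q : H) : u @ \oo --> p -> v @ \oo --> q ->
  dotv (u n) (v n) @[n --> \oo] --> dotv p q.
Proof.
move=> up vq; rewrite dotv_polar.
under eq_fun do rewrite dotv_polar.
apply: cvgMr_tmp; apply: cvgB; under eq_fun do rewrite expr2; rewrite expr2.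
  by apply: cvgM; apply: cvg_norm; apply: cvgD.
by apply: cvgM; apply: cvg_norm; apply: cvgB.
Qed.

End InnerProduct.

Section CompactBalls.
Context (R : realType) (H : euclideanType R).
Let e := vbasis {:H}.
Let e_basis : basis_of {:H} e. Proof. exact: vbasisP. Qed.

Lemma vecof_continuous : continuous (vecof e).
Proof.
apply: continuous_big => [|i _ v]; first exact: add_continuous.
apply: (@cvgZr_tmp _ _ _ (nbhs v) _ (fun w : 'rV[R]_(\dim {:H}) => w 0 i)).
exact: (@coord_continuous R 1 _ 0 i v).
Qed.

(** The coordinate map is bounded: the norm of [H], read in coordinates, is
    continuous and hence has a positive minimum on the unit sphere. *)
Lemma vecof_norm_ge : exists2 m : R, 0 < m &
  forall v : 'rV[R]_(\dim {:H}), m * `|v| <= `|vecof e v|.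
Proof.
pose S := [set v : 'rV[R]_(\dim {:H}) | `|v| = 1].
have Sc : compact S.
  apply: bounded_closed_compact.
    by exists 1; split=> // M M1 v /= ->; exact: ltW.
  apply: (@closed_comp _ _ (fun v : 'rV[R]_(\dim {:H}) => `|v|) [set 1]).
    by move=> v _; exact: norm_continuous.
  exact: closed_eq.
have unitS (v : 'rV[R]_(\dim {:H})) : v != 0 -> S (`|v|^-1 *: v).
  by move=> v0; rewrite /S /= normrZ ger0_norm ?invr_ge0// mulVf ?normr_eq0.
have [S0|/set0P S0] := eqVneq S set0.
  (* The sphere is empty when [H] is trivial. *)
  exists 1 => // v; have [->|/unitS] := eqVneq v 0; first by rewrite normr0 mulr0.
  by rewrite S0.
have cf : {within S, continuous (fun v => `|vecof e v|)}.
  apply: continuous_subspaceT => v; apply: (@continuous_comp _ _ _ (vecof e)).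
    exact: vecof_continuous.
  exact: norm_continuous.
have [c cS cmin] := compact_EVT_min S0 Sc cf.
have c0 : vecof e c != 0.
  rewrite vecof_eq0//; apply/eqP => c0.
  by move: cS; rewrite inE /S/= c0 normr0 => /esym/eqP; rewrite oner_eq0.
exists `|vecof e c|; first by rewrite normr_gt0.
move=> v; have [->|v0] := eqVneq v 0; first by rewrite normr0 mulr0.
have /mem_set/cmin := unitS _ v0.
rewrite linearZ/= normrZ ger0_norm ?invr_ge0//.
by rewrite ler_pdivlMl ?normr_gt0// mulrC.
Qed.

Lemma norm_ball_compact (x : H) r : compact [set y | `|x - y| <= r].
Proof.
have [m m0 mP] := vecof_norm_ge.
have -> : [set y | `|x - y| <= r] = vecof e @` [set v | `|x - vecof e v| <= r].
  apply/seteqP; split => [y/= yr|_ [v vr <-]//].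
  by exists (rVof e y); rewrite /= rVofK.
apply: continuous_compact.
  by apply: continuous_subspaceT; exact: vecof_continuous.
apply: bounded_closed_compact.
  exists ((`|x| + r) / m); split; first exact: num_real.
  move=> M /ltW rM v /= vr; apply: le_trans rM.
  rewrite ler_pdivlMr// mulrC; apply: le_trans (mP v) _.
  have -> : vecof e v = x - (x - vecof e v) by rewrite subKr.
  by apply: (le_trans (ler_normB _ _)); rewrite lerD2l.
apply: (@closed_comp _ _ (fun v => `|x - vecof e v|) [set z | z <= r]).
  move=> v _; apply: (@continuous_comp _ _ _ (fun v => x - vecof e v)).
    by apply: continuousB; [exact: cst_continuous | exact: vecof_continuous].
  exact: norm_continuous.
exact: closed_le.
Qed.

Implicit Types (u : nat -> H) (p x : H).

Lemma cvg_subseq u p (f : nat -> nat) :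
  (forall n, (n <= f n)%N) -> u @ \oo --> p -> (u \o f) @ \oo --> p.
Proof.
move=> fn up; apply: cvg_comp up => P [N _ NP]; exists N => // n /= Nn.
by apply: NP; exact: leq_trans Nn (fn n).
Qed.

Lemma cvg_lt_inv u p (f : nat -> nat) : (forall n, (n <= f n)%N) ->
  (forall n, `|p - u n| < (f n).+1%:R^-1) -> u @ \oo --> p.
Proof.
move=> fn uf; apply/cvgrPdist_lt => eps eps0.
near=> n; apply: lt_trans (uf n) _; apply: (@le_lt_trans _ _ (n.+1%:R^-1)).
  by rewrite lef_pV2 ?posrE// ler_nat ltnS.
near: n; exact: near_infty_natSinv_lt (PosNum eps0).
Unshelve. all: by end_near. Qed.

(** The indices [f n >= n] need not increase: this is enough to carry limits
    over, and it makes the extraction of a subsequence a plain choice. *)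
Lemma bounded_subseq u x r : (forall n, `|x - u n| <= r) ->
  exists p (f : nat -> nat), [/\ `|x - p| <= r, forall n, (n <= f n)%N &
    (u \o f) @ \oo --> p].
Proof.
move=> ur.
have ubd : (u @ \oo) [set y | `|x - y| <= r] by exists 0%N => // n _; exact: ur.
have [p [/= xp pc]] := @norm_ball_compact x r (u @ \oo) _ ubd.
have /choice[f fP] : forall n, exists m, (n <= m)%N /\ `|p - u m| < n.+1%:R^-1.
  move=> n.
  have [] := pc [set u m | m in [set m | (n <= m)%N]] (ball p n.+1%:R^-1).
  - by exists n => // m /= nm; exists m.
  - by apply: nbhsx_ballx; rewrite invr_gt0.
  by move=> _ [[m nm <-]]; rewrite -ball_normE; exists m.
exists p, f; split=> // [n|]; first by have [] := fP n.
by apply: (@cvg_lt_inv _ _ id) => // n /=; have [] := fP n.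
Qed.

End CompactBalls.

(** * Projections on locally closed sets *)

Section Projections.
Context (R : realType) (H : euclideanType R).
Implicit Types (x y p : H) (A V : set H).

Lemma dist_le A x y : A y -> dist x A <= `|x - y|.
Proof.
move=> Ay; apply: ge_inf; last by exists y.
by exists 0 => _ [z _ <-].
Qed.

Lemma dist_ge0 A x : A !=set0 -> 0 <= dist x A.
Proof.
move=> [y Ay]; apply: lb_le_inf; first by exists `|x - y|, y.
by move=> _ [z _ <-].
Qed.

Lemma closed_relP A V : closed_rel V A <->
  exists2 W, closed W & forall y, V y -> W y <-> A y.
Proof.
split=> [/closed_subspaceP[W Wcl WA]|[W Wcl WA]].
  exists W => // y Vy.
  have /(congr1 (@^~ y)) : W `&` V = A `&` V by rewrite WA -setIA setIid.
  rewrite /setI/mkset/= => E; split=> ?.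
  - by have [] : (A y /\ V y) by rewrite -E.
  - by have [] : (W y /\ V y) by rewrite E.
apply/closed_subspaceP; exists W => //; rewrite -setIA setIid.
by apply/seteqP; split=> y [? Vy]; split=> //; apply/(WA y Vy).
Qed.

Lemma closed_relS A V V' : V' `<=` V -> closed_rel V A -> closed_rel V' A.
Proof.
move=> VV' /closed_relP[W Wcl WA]; apply/closed_relP; exists W => // y.
by move=> /VV'; exact: WA.
Qed.

Lemma closed_rel_lim A V (u : nat -> H) p : closed_rel V A -> open V -> V p ->
  (forall n, A (u n)) -> u @ \oo --> p -> A p.
Proof.
move=> /closed_relP[W Wcl WA] Vo Vp Au up; apply/WA => //.
apply: (@closed_cvg _ _ _ _ u W Wcl _ p up).
have : \forall n \near \oo, V (u n) by apply: up; exact: open_nbhs_nbhs.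
by apply: filterS => n /WA ->.
Qed.

(** Points of [A] at least as close to [y] as [x] stay in the ball of radius
    [rho], where [A] is closed: a minimum is attained there by compactness. *)
Lemma proj_exists A x rho y : A x -> closed_rel (ball x rho) A ->
  `|y - x| < rho / 2 -> exists2 z, Defs.proj A y z & ball x rho z.
Proof.
move=> Ax /closed_relP[W Wcl WA] yx.
pose K := [set z | `|y - z| <= `|y - x|].
have KB z : K z -> ball x rho z.
  rewrite /K/= -ball_normE /= => Kz.
  rewrite -(subrK y x) -addrA; apply: le_lt_trans (ler_normD _ _) _.
  rewrite distrC; lra.
have KWc : compact (K `&` W).
  by apply: compact_closedI => //; exact: norm_ball_compact.
have KW0 : K `&` W !=set0.
  by exists x; split; [rewrite /K/= | apply/WA => //; apply: KB; rewrite /K/=].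
have cf : {within K `&` W, continuous (fun z => `|y - z|)}.
  apply: continuous_subspaceT => z.
  apply: (@continuous_comp _ _ _ (fun v => y - v)); last exact: norm_continuous.
  by apply: continuousB; [exact: cst_continuous | exact: cvg_id].
have [z] := compact_EVT_min KW0 KWc cf; rewrite inE => -[Kz Wz] zmin.
have Bz := KB _ Kz; exists z => //; have Az : A z by apply/WA.
split=> //; apply/eqP; rewrite eq_le dist_le// andbT.
apply: lb_le_inf; first by exists `|y - z|, z.
move=> _ [t At <-]; have [yt|/ltW yt] := leP `|y - t| `|y - x|.
  by apply: zmin; rewrite inE; split => //; apply/WA => //; exact: KB.
exact: le_trans yt.
Qed.

Lemma quasiproj_exists A x rho sigma y : A x -> closed_rel (ball x rho) A ->
  1 <= sigma -> `|y - x| < rho / 2 -> quasiproj A y sigma !=set0.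
Proof.
move=> Ax Acl s1 yx; have [z [Az zd] _] := proj_exists Ax Acl yx.
by exists z; split=> //; rewrite zd ler_peMl// dist_ge0//; exists x.
Qed.

End Projections.

(** * Normal cones and the angle between two sets *)

Section Normals.
Context (R : realType) (H : euclideanType R).
Implicit Types (u v x : H) (A B : set H).

Lemma prox_normal_scale A x v k : 0 < k -> prox_normal A x v ->
  prox_normal A x (k *: v).
Proof.
move=> k0 [t t0 tP]; exists (t / k); first exact: divr_gt0.
by rewrite scalerA divfK// gt_eqF.
Qed.

Lemma prox_normal_proj A x y : Defs.proj A x y -> prox_normal A y (x - y).
Proof. by move=> yP; exists 1 => //; rewrite scale1r addrC subrK. Qed.

Lemma prox_normal_lim A x v : A x -> prox_normal A x v -> lim_normal A x v.
Proof.
by move=> Ax vN; exists (fun=> x), (fun=> v); split=> //; exact: cvg_cst.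
Qed.

Lemma lim_normal0 A x : A x -> lim_normal A x 0.
Proof.
move=> Ax; apply: prox_normal_lim => //; exists 1 => //; rewrite scaler0 addr0.
split=> //; rewrite subrr normr0; apply/eqP; rewrite eq_le dist_ge0 /=.
  by have := dist_le x Ax; rewrite subrr normr0.
by exists x.
Qed.

Lemma cos_angle_ge A B x u v : lim_normal A x u -> lim_normal B x v ->
  `|u| <= 1 -> `|v| <= 1 -> - dotv u v <= cos_angle A B x.
Proof.
move=> uN vN u1 v1; apply: ub_le_sup; last first.
  exists (- u); first by split; [exists u | rewrite /mkset/= normrN].
  by exists v => //; rewrite dotvNl.
exists 1 => _ [_ [[w _ <-] /= w1] [z [_ /= z1] <-]].
by apply: (le_trans (dotv_le_norm _ _)); rewrite mulr_ile1.
Qed.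

Lemma cos_angle_ge0 A B x : A x -> B x -> 0 <= cos_angle A B x.
Proof.
move=> Ax Bx; have := cos_angle_ge (lim_normal0 Ax) (lim_normal0 Bx).
by rewrite linear0l oppr0 normr0; apply.
Qed.

Definition angle_on A B x rho c := forall a b u v,
  A a -> B b -> ball x rho a -> ball x rho b ->
  prox_normal A a u -> prox_normal B b v -> - dotv u v <= c * (`|u| * `|v|).

Lemma angle_onS A B x rho rho' c : rho' <= rho -> angle_on A B x rho c ->
  angle_on A B x rho' c.
Proof.
by move=> le ang a b u v Aa Bb /(le_ball le) ? /(le_ball le) ?; exact: ang.
Qed.

Lemma angle_onC A B x rho c : angle_on A B x rho c -> angle_on B A x rho c.
Proof. by move=> ang b a v u *; rewrite dotvC [`|v| * _]mulrC; apply: (ang a b). Qed.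

(** Otherwise there are unit proximal normals at points tending to [x] that
    violate the bound; by compactness they accumulate at limiting normals at
    [x], whose angle contradicts the definition of the cosine. *)
Lemma cos_angle_near A B x c : cos_angle A B x < c ->
  exists2 rho, 0 < rho & angle_on A B x rho c.
Proof.
move=> ltc.
suff [rho rho0 rhoP] : exists2 rho, 0 < rho & forall a b u v, A a -> B b ->
    ball x rho a -> ball x rho b -> prox_normal A a u -> prox_normal B b v ->
    `|u| = 1 -> `|v| = 1 -> - dotv u v <= c.
  exists rho => // a b u v Aa Bb xa xb uN vN.
  have [->|u0] := eqVneq u 0.
    by rewrite linear0l normr0 !(mul0r, mulr0) oppr0.
  have [->|v0] := eqVneq v 0; first by rewrite linear0r normr0 !mulr0 oppr0.
  have u1 : 0 < `|u|^-1 by rewrite invr_gt0 normr_gt0.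
  have v1 : 0 < `|v|^-1 by rewrite invr_gt0 normr_gt0.
  have := rhoP _ _ _ _ Aa Bb xa xb (prox_normal_scale u1 uN) (prox_normal_scale v1 vN).
  rewrite !normrZ !gtr0_norm// !mulVf ?normr_eq0// => /(_ erefl erefl).
  rewrite dotvZl dotvZr mulrA mulrC -mulNr -invfM ler_pdivrMr//.
  by rewrite mulr_gt0 ?normr_gt0.
apply: contrapT => noP.
have /choice[f fP] : forall n : nat, exists s : H * H * (H * H),
  [/\ A s.1.1 /\ B s.1.2,
   `|x - s.1.1| < n.+1%:R^-1 /\ `|x - s.1.2| < n.+1%:R^-1,
   prox_normal A s.1.1 s.2.1 /\ prox_normal B s.1.2 s.2.2,
   `|s.2.1| = 1 /\ `|s.2.2| = 1 & c < - dotv s.2.1 s.2.2].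
  move=> n; apply: contrapT => noPn; apply: noP; exists n.+1%:R^-1.
    by rewrite invr_gt0.
  move=> a b u v Aa Bb; rewrite -ball_normE /= => xa xb uN vN u1 v1.
  rewrite leNgt; apply/negP => cuv; apply: noPn.
  by exists (a, b, (u, v)).
have bd1 n : `|0 - (f n).2.1| <= 1.
  by rewrite sub0r normrN; have [_ _ _ [-> _] _] := fP n.
have [u [g [u1 gn gu]]] := bounded_subseq bd1.
have bd2 n : `|0 - (f (g n)).2.2| <= 1.
  by rewrite sub0r normrN; have [_ _ _ [_ ->] _] := fP (g n).
have [v [h [v1 hn hv]]] := bounded_subseq bd2.
have ghn n : (n <= g (h n))%N by exact: leq_trans (gn _).
have uN : lim_normal A x u.
  exists (fun n => (f (g (h n))).1.1), (fun n => (f (g (h n))).2.1); split.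
  - by move=> n; have [[? ?] _ [? ?] _ _] := fP (g (h n)).
  - apply: (@cvg_lt_inv _ _ _ _ (g \o h)) => // n.
    by have [_ [? ?] _ _ _] := fP (g (h n)).
  - exact: cvg_subseq gu.
have vN : lim_normal B x v.
  exists (fun n => (f (g (h n))).1.2), (fun n => (f (g (h n))).2.2); split.
  - by move=> n; have [[? ?] _ [? ?] _ _] := fP (g (h n)).
  - apply: (@cvg_lt_inv _ _ _ _ (g \o h)) => // n.
    by have [_ [? ?] _ _ _] := fP (g (h n)).
  - exact: hv.
move: u1 v1; rewrite !sub0r !normrN => u1 v1.
have := cos_angle_ge uN vN u1 v1; rewrite leNgt => /negP; apply.
apply: lt_le_trans ltc _.
have uvc : - dotv (f (g (h n))).2.1 (f (g (h n))).2.2 @[n --> \oo] --> - dotv u v.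
  by apply: cvgN; apply: cvg_dotv => //; exact: cvg_subseq gu.
apply: (@closed_cvg _ _ _ _ _ [set z | c <= z] _ _ _ uvc); first exact: closed_ge.
by apply: nearW => n /=; have [_ _ _ _ /ltW] := fP (g (h n)).
Qed.

End Normals.

(** * Angles on the unit circle *)

Section UnitCircle.
Context (R : realType).
Implicit Types p q r c t : R.

(** This is cos (acos p - acos q), as long as [p] and [q] lie in [-1, 1]. *)
Definition cos_acosB p q :=
  p * q + Num.sqrt (1 - p ^+ 2) * Num.sqrt (1 - q ^+ 2).

Lemma cos_acosBE p q : -1 <= p <= 1 -> -1 <= q <= 1 ->
  cos_acosB p q = cos (acos p - acos q).
Proof. by move=> p1 q1; rewrite cosB !acosK ?in_itv// !sin_acos. Qed.

Lemma acos_itv p : -1 <= p <= 1 -> acos p \in `[0, pi].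
Proof. by move=> p1; rewrite in_itv/= acos_ge0// acos_lepi. Qed.

Lemma acos_lt p q : -1 <= p -> p < q -> q <= 1 -> acos q < acos p.
Proof.
move=> p1 pq q1.
have pI : -1 <= p <= 1 by rewrite p1 (le_trans (ltW pq)).
have qI : -1 <= q <= 1 by rewrite q1 (le_trans p1 (ltW pq)).
by rewrite -ltr_cos ?acos_itv// !acosK ?in_itv.
Qed.

Lemma acos_le p q : -1 <= p -> p <= q -> q <= 1 -> acos q <= acos p.
Proof.
move=> p1; rewrite le_eqVlt => /predU1P[->//|pq] q1.
by apply: ltW; exact: acos_lt.
Qed.

(** As the cosine decreases on [0, pi]: moving [p] towards [r] decreases the
    angle between them. *)
Lemma cos_acosB_lt p q r : -1 <= p -> p < q -> q <= r -> r <= 1 ->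
  cos_acosB p r < cos_acosB q r.
Proof.
move=> p1 pq qr r1.
have q1 : -1 <= q := le_trans p1 (ltW pq).
have pI : -1 <= p <= 1 by rewrite p1 (le_trans (ltW pq))// (le_trans qr).
have qI : -1 <= q <= 1 by rewrite q1 (le_trans qr).
have rI : -1 <= r <= 1 by rewrite r1 (le_trans q1).
have qp : acos q < acos p by apply: acos_lt => //; exact: le_trans r1.
have rq : acos r <= acos q by exact: acos_le.
have := acos_itv pI; have := acos_itv qI; have := acos_itv rI.
rewrite !in_itv/= => /andP[r0 rpi] /andP[q0 qpi] /andP[p0 ppi].
rewrite !cos_acosBE// ltr_cos ?in_itv/=; first by rewrite ltrD2r.
  by apply/andP; split; lra.
by apply/andP; split; lra.
Qed.

Lemma cos_acosB_le p q r : -1 <= p -> p <= q -> q <= r -> r <= 1 ->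
  cos_acosB p r <= cos_acosB q r.
Proof.
move=> p1; rewrite le_eqVlt => /predU1P[->//|pq] qr r1.
by apply: ltW; exact: cos_acosB_lt.
Qed.

Lemma cos_acosBC p q : cos_acosB p q = cos_acosB q p.
Proof. by rewrite /cos_acosB mulrC [X in _ + X]mulrC. Qed.

Lemma cos_acosBNN p q : cos_acosB (- p) (- q) = cos_acosB p q.
Proof. by rewrite /cos_acosB mulrNN !sqrrN. Qed.

Lemma cos_acosB_ge0 p q : 0 <= p -> 0 <= q -> 0 <= cos_acosB p q.
Proof. by move=> p0 q0; apply: addr_ge0; apply: mulr_ge0. Qed.

Lemma sigma_cos_acosBE c sigma : 1 <= sigma ->
  sigma * cos_acosB c sigma^-1 =
  c + Num.sqrt (1 - c ^+ 2) * Num.sqrt (sigma ^+ 2 - 1).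
Proof.
move=> s1; have s0 : 0 < sigma by apply: lt_le_trans s1.
have -> : sigma ^+ 2 - 1 = sigma ^+ 2 * (1 - sigma^-1 ^+ 2).
  by field; rewrite gt_eqF.
rewrite sqrtrM ?sqr_ge0// sqrtr_sqr ger0_norm ?ltW// /cos_acosB.
by field; rewrite gt_eqF.
Qed.

(** The strict gain from [c1] to [c] pays for errors proportional to [eps],
    because the left-hand sides are continuous in [eps]. *)
Lemma cos_acosB_slack c1 c t k m : 0 <= c1 -> c1 < c -> c < t -> t <= 1 ->
  exists2 eps : R, 0 < eps &
    c1 <= t - k * eps /\ cos_acosB c1 (t - k * eps) + m * eps <= cos_acosB c t.
Proof.
move=> c10 c1c ct t1.
pose f (e : R) := cos_acosB c1 (t - k * e) + m * e.
pose g (e : R) := t - k * e.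
have gc : g x @[x --> 0] --> g 0.
  apply: cvgB; first exact: cvg_cst.
  by apply: cvgMl_tmp; exact: cvg_id.
have fc : f x @[x --> 0] --> f 0.
  apply: cvgD; last by apply: cvgMl_tmp; exact: cvg_id.
  rewrite /cos_acosB; apply: cvgD; first by apply: cvgM => //; exact: cvg_cst.
  apply: cvgMl_tmp.
  apply: (@cvg_comp _ _ _ (fun x => 1 - g x ^+ 2) Num.sqrt _
    (nbhs (1 - g 0 ^+ 2))); last exact: sqrt_continuous.
  apply: cvgB; first exact: cvg_cst.
  by rewrite expr2; under eq_fun do rewrite expr2; exact: (cvgM gc gc).
have g0 : c1 < g 0 by rewrite /g mulr0 subr0 (lt_trans c1c).
have f0 : f 0 < cos_acosB c t.
  rewrite /f !mulr0 subr0 addr0; apply: cos_acosB_lt => //; last exact: ltW.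
  by rewrite (le_trans _ c10)// lerN10.
have h : \forall x \near (0 : R)^'+, c1 < g x /\ f x < cos_acosB c t.
  apply: (@cvg_at_right_filter R R id 0 0 cvg_id).
  exact: filterI (cvgr_gt (g 0) gc _ g0) (cvgr_lt (f 0) fc _ f0).
suff /(@filter_ex _ _ (at_right_proper_filter (0 : R)))[e [[/ltW h1 /ltW h2] e0]] :
    \forall x \near (0 : R)^'+, (c1 < g x /\ f x < cos_acosB c t) /\ 0 < x.
  by exists e.
by apply: filterI h _; exact: nbhs_right_gt.
Qed.

End UnitCircle.

(** The spherical triangle inequality for the directions of [w], [u] and [v];
    a vector [v] shorter than one only makes the inequality weaker.  The two
    appeals to monotonicity replace <u, w> by [c] and <u, v> by [s]. *)
Lemma dotv_le_cos_acosB (R : realType) (H : euclideanType R) (u v w : H)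
    (c s : R) : `|u| = 1 -> `|w| = 1 -> `|v| <= 1 -> 0 <= c -> c <= s ->
  dotv u w <= c -> s <= dotv u v -> dotv w v <= cos_acosB c s.
Proof.
move=> u1 w1 v1 c0 cs uwc suv.
have abs1 (x : H) : `|x| <= 1 -> -1 <= dotv u x <= 1.
  move=> x1; rewrite -[X in X && _]lerN2 opprK -dotvNr.
  by rewrite !(le_trans (dotv_le_norm _ _))// u1 mul1r ?normrN.
have /andP[uwN1 uw1] : -1 <= dotv u w <= 1 by apply: abs1; rewrite w1.
have /andP[uvN1 uv1] := abs1 v v1.
(* The component of [x] orthogonal to [u]. *)
have orthE (x : H) : `|x| <= 1 ->
    `|x - dotv u x *: u| <= Num.sqrt (1 - dotv u x ^+ 2).
  move=> x1; rewrite -[leLHS]ger0_norm// -sqrtr_sqr ler_wsqrtr//.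
  rewrite sqr_normv !dotvE (dotvC x u) -!sqr_normv u1 expr1n.
  have : `|x| ^+ 2 <= 1 by rewrite exprn_ile1.
  lra.
apply: (@le_trans _ _ (cos_acosB (dotv u w) (dotv u v))).
  rewrite /cos_acosB -lerBlDl.
  have -> : dotv w v - dotv u w * dotv u v =
      dotv (w - dotv u w *: u) (v - dotv u v *: u).
    rewrite !dotvE (dotvC w u) -(sqr_normv u) u1; ring.
  apply: le_trans (dotv_le_norm _ _) _.
  by apply: ler_pM => //; apply: orthE => //; rewrite w1.
apply: (@le_trans _ _ (cos_acosB c (dotv u v))).
  by apply: cos_acosB_le => //; exact: le_trans suv.
(* The reflection of the circle reverses the order of [c <= s <= <u, v>]. *)
rewrite -cos_acosBNN cos_acosBC -[leRHS]cos_acosBNN [leRHS]cos_acosBC.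
by apply: cos_acosB_le; lra.
Qed.

(** * Contraction of the distances in one half-step *)

Section HalfStep.
Context (R : realType) (H : euclideanType R).
Implicit Types (x : H) (A B : set H).

Definition regular_on A x rho eps := closed_rel (ball x rho) A /\
  forall y y' v, A y -> ball x rho y -> A y' -> ball x rho y' ->
    prox_normal A y v -> dotv v (y' - y) <= eps * `|v| * `|y' - y|.

Lemma regular_onS A x rho rho' eps : rho' <= rho -> regular_on A x rho eps ->
  regular_on A x rho' eps.
Proof.
move=> le [clA reg]; split; first exact: closed_relS (le_ball le) clA.
by move=> y y' v Ay yb Ay' yb'; apply: reg => //; exact: le_ball le _ _.
Qed.

Lemma super_regular_on A x eps : super_regular A x -> 0 < eps ->
  exists2 rho, 0 < rho & regular_on A x rho eps.
Proof.
move=> sr eps0; have [rho [rho0 clA reg]] := sr eps eps0.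
exists rho => //; split=> // y y' v Ay xy Ay' xy' vN.
by apply: reg => //; exact: prox_normal_lim.
Qed.

(** Half the radius, because the exact projection of a point may be twice as
    far from [x] as the point itself. *)
Definition contracts A B x rho sigma m := forall a b,
  A a -> `|a - x| < rho / 2 -> quasiproj B a sigma b -> `|b - x| < rho / 2 ->
  dist b A <= m * dist a B.

(** Two identities reduce the claim to the angle estimate on the unit circle:
    <U, a - b> = d^2 - <U, b - b'> and e^2 = -<W, a - b> + <W, a - a'>.
    Regularity of [B] and of [A] bounds their last terms, because |b - b'| is at
    most (1 + sigma) d and |a - a'| is at most 2 sigma d. *)
Lemma quasiproj_contract A B x rho eps c1 c sigma : A x -> B x ->
  regular_on A x rho eps -> regular_on B x rho eps -> angle_on A B x rho c1 ->
  1 <= sigma -> 0 < eps -> 0 <= c1 -> 0 <= c ->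
  c1 <= sigma^-1 - (1 + sigma) / sigma * eps ->
  cos_acosB c1 (sigma^-1 - (1 + sigma) / sigma * eps) + 2 * eps <=
    cos_acosB c sigma^-1 ->
  contracts A B x rho sigma (sigma * cos_acosB c sigma^-1).
Proof.
move=> Ax Bx [clA regA] [clB regB] ang s1 eps0 c10 c0.
set s := _ - _ * eps => c1s slack a b Aa ax [Bb ab] bx.
have s0 : 0 < sigma by apply: lt_le_trans s1.
have [b' b'P xb'] := proj_exists Bx clB ax.
have [a' a'P xa'] := proj_exists Ax clA bx.
have uN := prox_normal_proj b'P; have wN := prox_normal_proj a'P.
have [Bb' Ud] := b'P; have [Aa' We] := a'P.
have half y : `|y - x| < rho / 2 -> ball x rho y.
  by rewrite -ball_normE /= [X in _ -> X < _]distrC; have := normr_ge0 (y - x); lra.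
have xa := half _ ax; have xb := half _ bx.
set U := a - b' in Ud uN; set W := b - a' in We wN.
have d0 : 0 <= dist a B by rewrite -Ud.
have e0 : 0 <= dist b A by rewrite -We.
have M0 : 0 <= cos_acosB c sigma^-1.
  by apply: cos_acosB_ge0; rewrite ?invr_ge0// ltW.
have eab : dist b A <= `|a - b| by rewrite distrC dist_le.
have [d00|dN] := eqVneq (dist a B) 0.
  by rewrite d00 mulr0; apply: le_trans eab _; rewrite (le_trans ab)// d00 mulr0.
have [->|eN] := eqVneq (dist b A) 0; first by rewrite !mulr_ge0// ltW.
move: ab Ud We d0 e0 eab dN eN; set d := dist a B; set e := dist b A.
move=> ab Ud We d0 e0 eab dN eN.
have {dN d0}d0 : 0 < d by rewrite lt_neqAle eq_sym dN.
have {eN e0}e0 : 0 < e by rewrite lt_neqAle eq_sym eN.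
have sd0 : 0 < sigma * d by rewrite mulr_gt0.
have hU : dotv U (b - b') <= eps * d * ((1 + sigma) * d).
  apply: le_trans (regB _ _ _ Bb' xb' Bb xb uN) _.
  rewrite Ud; apply: ler_wpM2l; first by rewrite mulr_ge0 ?ltW.
  have -> : b - b' = U - (a - b) by rewrite /U opprB [RHS]addrC addrA subrK.
  by rewrite (le_trans (ler_normB _ _))// Ud; lra.
have hW : dotv W (a - a') <= eps * e * (2 * (sigma * d)).
  apply: le_trans (regA _ _ _ Aa' xa' Aa xa wN) _.
  rewrite We; apply: ler_wpM2l; first by rewrite mulr_ge0 ?ltW.
  have -> : a - a' = (a - b) + W by rewrite /W addrA subrK.
  by rewrite (le_trans (ler_normD _ _))// We; lra.
have hWU : - dotv W U <= c1 * (e * d).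
  by have := ang _ _ _ _ Aa' Bb' xa' xb' wN uN; rewrite We Ud.
have uv : s <= dotv (d^-1 *: U) ((sigma * d)^-1 *: (a - b)).
  rewrite dotvZl dotvZr.
  have -> : dotv U (a - b) = d ^+ 2 - dotv U (b - b').
    have -> : a - b = U - (b - b') by rewrite /U opprB addrA subrK.
    by rewrite dotvDr dotvNr -sqr_normv Ud.
  have -> : d^-1 * ((sigma * d)^-1 * (d ^+ 2 - dotv U (b - b'))) =
      sigma^-1 - dotv U (b - b') / (sigma * d ^+ 2).
    by field; rewrite !gt_eqF.
  rewrite /s lerD2l lerN2 ler_pdivrMr ?mulr_gt0 ?exprn_gt0//.
  by apply: le_trans hU _; apply: le_of_eq; field; rewrite gt_eqF.
have uw : dotv (d^-1 *: U) (- (e^-1 *: W)) <= c1.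
  rewrite dotvNr dotvZl dotvZr (dotvC U W).
  have -> : - (d^-1 * (e^-1 * dotv W U)) = - dotv W U / (e * d).
    by field; rewrite !gt_eqF.
  by rewrite ler_pdivrMr ?mulr_gt0.
have wv : - dotv W (a - b) <= e * (sigma * d) * cos_acosB c1 s.
  have -> : - dotv W (a - b) = e * (sigma * d) *
      dotv (- (e^-1 *: W)) ((sigma * d)^-1 *: (a - b)).
    by rewrite dotvNl dotvZl dotvZr; field; rewrite !gt_eqF.
  rewrite ler_wpM2l//; first by rewrite ltW// mulr_gt0.
  apply: dotv_le_cos_acosB c10 c1s uw uv;
    rewrite ?normrN normrZ gtr0_norm ?invr_gt0// ?Ud ?We ?mulVf ?gt_eqF//.
  by rewrite ler_pdivrMl// mulr1.
rewrite -(ler_pM2l e0).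
have -> : e * e = - dotv W (a - b) + dotv W (a - a').
  by rewrite -dotvNr opprB -dotvDr addrA subrK -sqr_normv We expr2.
apply: (@le_trans _ _ (e * (sigma * d) * (cos_acosB c1 s + 2 * eps))).
  by apply: le_trans (lerD wv hW) _; apply: le_of_eq; ring.
apply: (@le_trans _ _ (e * (sigma * d) * cos_acosB c sigma^-1)).
  by rewrite ler_wpM2l// ltW// mulr_gt0.
by apply: le_of_eq; ring.
Qed.

Lemma contracts_near A B x r1 c1 c sigma : A x -> B x ->
  super_regular A x -> super_regular B x ->
  0 < r1 -> angle_on A B x r1 c1 -> 0 <= c1 -> c1 < c ->
  1 <= sigma -> c < sigma^-1 ->
  exists2 rho, 0 < rho & forall r, r <= rho ->
    [/\ closed_rel (ball x r) A, closed_rel (ball x r) B &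
        contracts A B x r sigma (sigma * cos_acosB c sigma^-1)].
Proof.
move=> Ax Bx srA srB r10 ang c10 c1c s1 cs.
have is1 : sigma^-1 <= 1 by rewrite invf_le1// (lt_le_trans ltr01).
have [e e0 [e1 e2]] := cos_acosB_slack ((1 + sigma) / sigma) 2 c10 c1c cs is1.
have [rA rA0 regA] := super_regular_on srA e0.
have [rB rB0 regB] := super_regular_on srB e0.
exists (Num.min r1 (Num.min rA rB)); first by rewrite !lt_min r10 rA0.
move=> r; rewrite !le_min => /and3P[rr1 rrA rrB].
have {}regA := regular_onS rrA regA; have {}regB := regular_onS rrB regB.
split; [by case: regA | by case: regB |].
have c0 : 0 <= c := le_trans c10 (ltW c1c).
exact: quasiproj_contract Ax Bx regA regB (angle_onS rr1 ang) s1 e0 c10 c0 e1 e2.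
Qed.

End HalfStep.

(** * Convergence of the iteration *)

Section Iteration.
Context (R : realType) (H : euclideanType R) (A B : set H) (x : H).
Context (sigmaA sigmaB mA mB rho : R) (a0 : H).
Context (Ax : A x) (Bx : B x) (rho0 : 0 < rho).
Context (sA1 : 1 <= sigmaA) (sB1 : 1 <= sigmaB) (mA0 : 0 <= mA) (mB0 : 0 <= mB).
Context (clA : closed_rel (ball x rho) A) (clB : closed_rel (ball x rho) B).
Context (ctAB : contracts A B x rho sigmaB mB).
Context (ctBA : contracts B A x rho sigmaA mA).
Let q := mA * mB.
Context (q1 : q < 1).
(* The quasiprojections on [B] of a point this close to [x] are at distance less
   than [rho / 2] from [x]. *)
Let r := rho / (2 * (sigmaB + 1)).
Let d := dist a0 B.
(* A full step from [a] has length at most [l * dist a B], so that the whole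
   trajectory has length at most [K * d]. *)
Let l := sigmaB + sigmaA * mB.
Let K := l / (1 - q).
Context (Aa0 : A a0) (a0x : `|a0 - x| + K * d < r).

Let q0 : 0 <= q. Proof. exact: mulr_ge0. Qed.
Let d0 : 0 <= d. Proof. by apply: dist_ge0; exists x. Qed.
Let l0 : 0 <= l. Proof. by rewrite addr_ge0 ?mulr_ge0// (le_trans ler01). Qed.
Let K0 : 0 <= K. Proof. by rewrite divr_ge0// subr_ge0 ltW. Qed.
Let KE : l = K * (1 - q). Proof. by rewrite divfK// gt_eqF// subr_gt0. Qed.
Let s10 : 0 < sigmaB + 1.
Proof. by rewrite ltr_wpDl// (le_trans ler01). Qed.

Let r_half : r <= rho / 2.
Proof.
rewrite /r invfM mulrA ler_pdivrMr// ler_peMr//; first by rewrite divr_ge0// ltW.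
by rewrite lerDr (le_trans ler01).
Qed.

Let quasiproj_near a b :
  `|a - x| < r -> quasiproj B a sigmaB b -> `|b - x| < rho / 2.
Proof.
move=> ar [Bb ab].
have -> : b - x = (a - x) - (a - b) by rewrite opprB [RHS]addrC addrA subrK.
apply: le_lt_trans (ler_normB _ _) _.
have dx : dist a B <= `|a - x| by exact: dist_le.
have sdx : sigmaB * dist a B <= sigmaB * `|a - x|.
  by rewrite ler_wpM2l// (le_trans ler01).
have : (sigmaB + 1) * `|a - x| < (sigmaB + 1) * r by rewrite ltr_pM2l.
have -> : (sigmaB + 1) * r = rho / 2 by rewrite /r; field; rewrite gt_eqF.
lra.
Qed.

Let half_steps a b a' : A a -> `|a - x| < r ->
  quasiproj B a sigmaB b -> quasiproj A b sigmaA a' ->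
  [/\ `|b - x| < rho / 2, `|a - b| <= sigmaB * dist a B,
    `|b - a'| <= sigmaA * mB * dist a B & dist b A <= mB * dist a B].
Proof.
move=> Aa ar bP a'P; have bx := quasiproj_near ar bP.
have dba : dist b A <= mB * dist a B.
  by apply: ctAB => //; exact: lt_le_trans r_half.
split=> //; first by case: bP.
case: a'P => _ /le_trans; apply; rewrite -mulrA ler_wpM2l//.
by rewrite (le_trans ler01).
Qed.

(** The bound on |a_N - a_0| is the partial sum of the geometric series of the
    step lengths.  Only the first [N] steps are assumed, as the next
    quasiprojections are known to exist only once a_N is known to be near
    [x]. *)
Lemma qap_invariant a b N : a 0%N = a0 ->
  (forall n, (n < N)%N -> qap_step A B sigmaA sigmaB a b n) ->
  [/\ A (a N), `|a N - a0| <= K * (1 - q ^+ N) * d, `|a N - x| < r &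
      dist (a N) B <= q ^+ N * d].
Proof.
move=> a0E; elim: N => [|N IH] steps.
  rewrite a0E subrr normr0 expr0 subrr mulr0 mul0r mul1r; split=> //.
  by apply: le_lt_trans a0x; rewrite lerDl mulr_ge0.
have {IH}[|AaN aNa0 aNx dN] := IH.
  by move=> n nN; apply: steps; exact: ltnW.
have [bP aP] := steps N (ltnSn N).
have [bx ab ba' dba] := half_steps AaN aNx bP aP.
have Aa' : A (a N.+1) by case: aP.
have aa' : `|a N.+1 - a N| <= l * (q ^+ N * d).
  have -> : a N.+1 - a N = - (a N - b N.+1 + (b N.+1 - a N.+1)).
    by rewrite addrA subrK opprB.
  rewrite normrN; apply: le_trans (ler_normD _ _) _.
  by apply: le_trans (lerD ab ba') _; rewrite -mulrDl ler_wpM2l.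
have a'a0 : `|a N.+1 - a0| <= K * (1 - q ^+ N.+1) * d.
  rewrite -(subrK (a N) (a N.+1)) -addrA; apply: le_trans (ler_normD _ _) _.
  by apply: le_trans (lerD aa' aNa0) _; rewrite KE exprS; apply: le_of_eq; ring.
have a'x : `|a N.+1 - x| < r.
  rewrite -(subrK a0 (a N.+1)) -addrA; apply: le_lt_trans (ler_normD _ _) _.
  apply: le_lt_trans a0x; rewrite [leRHS]addrC lerD2r; apply: le_trans a'a0 _.
  by rewrite ler_wpM2r// ler_piMr// lerBlDr lerDl exprn_ge0.
split=> //.
have da' : dist (a N.+1) B <= mA * dist (b N.+1) A.
  by apply: ctBA => //; [case: bP | exact: lt_le_trans r_half].
apply: le_trans da' _; rewrite exprS -mulrA /q -mulrA ler_wpM2l//.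
by apply: le_trans dba _; rewrite ler_wpM2l.
Qed.

Lemma qap_exists : qap_well_defined A B sigmaA sigmaB a0.
Proof.
move=> N a b aE steps; have [AaN _ aNx _] := qap_invariant aE steps.
split; first by apply: quasiproj_exists Bx clB sB1 _; exact: lt_le_trans r_half.
by move=> y /(quasiproj_near aNx) yx; exact: quasiproj_exists Ax clA sA1 yx.
Qed.

Lemma qap_cvg a b : qap A B sigmaA sigmaB a0 a b ->
  exists xhat, [/\ (A `&` B) xhat, a @ \oo --> xhat, b @ \oo --> xhat,
    `|xhat - x| <= `|a0 - x| + K * d &
    forall n, `|xhat - a n| <= K * q ^+ n * d /\
      `|xhat - b n.+1| <= (sigmaA * mB + K * q) * q ^+ n * d].
Proof.
move=> [aE steps].
have inv n := qap_invariant aE (fun m (_ : (m < n)%N) => steps m).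
have ab n : `|a n - b n.+1| <= sigmaB * (q ^+ n * d) /\
    `|b n.+1 - a n.+1| <= sigmaA * mB * (q ^+ n * d).
  have [Aan _ anx dn] := inv n; have [bP aP] := steps n.
  have [_ h1 h2 _] := half_steps Aan anx bP aP.
  split; [apply: le_trans h1 _ | apply: le_trans h2 _];
    by rewrite ler_wpM2l ?mulr_ge0// (le_trans ler01).
have aa k n : `|a (n + k)%N - a n| <= K * (q ^+ n - q ^+ (n + k)) * d.
  elim: k => [|k IH]; first by rewrite addn0 !subrr normr0 mulr0 mul0r.
  rewrite addnS -(subrK (a (n + k)%N) (a (n + k).+1)) -addrA.
  apply: le_trans (ler_normD _ _) _; have [h1 h2] := ab (n + k)%N.
  have : `|a (n + k).+1 - a (n + k)%N| <= l * (q ^+ (n + k) * d).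
    rewrite distrC; apply: le_trans (ler_distD (b (n + k).+1) _ _) _.
    by apply: le_trans (lerD h1 h2) _; rewrite -mulrDl.
  move=> /lerD /(_ IH) /le_trans; apply.
  by rewrite KE exprS; apply: le_of_eq; ring.
have bd n : `|x - a n| <= `|a0 - x| + K * d.
  have [_ h _ _] := inv n; apply: le_trans (ler_distD a0 _ _) _.
  rewrite (distrC x) (distrC a0 (a n)) lerD2l; apply: le_trans h _.
  by rewrite ler_wpM2r// ler_piMr// lerBlDr lerDl exprn_ge0.
have [xhat [f [xx fn af]]] := bounded_subseq bd.
have xa n : `|xhat - a n| <= K * q ^+ n * d.
  have cv : `|(a \o f) m - a n| @[m --> \oo] --> `|xhat - a n|.
    by apply: cvg_norm; apply: cvgB => //; exact: cvg_cst.
  apply: (@closed_cvg _ _ _ _ _ [set z | z <= K * q ^+ n * d] _ _ _ cv).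
    exact: closed_le.
  exists n => // m /= nm; rewrite -(subnKC (leq_trans nm (fn m))).
  apply: le_trans (aa _ _) _; rewrite ler_wpM2r// ler_wpM2l//.
  by rewrite lerBlDr lerDl exprn_ge0.
have xb n : `|xhat - b n.+1| <= (sigmaA * mB + K * q) * q ^+ n * d.
  have [_ h] := ab n; apply: le_trans (ler_distD (a n.+1) _ _) _.
  apply: le_trans (lerD (xa n.+1) _) _; first by rewrite distrC; exact: h.
  by rewrite exprS; apply: le_of_eq; ring.
have cv0 (M : R) (u : nat -> H) :
    (forall n, `|xhat - u n| <= M * q ^+ n * d) -> u @ \oo --> xhat.
  move=> uM; apply/cvgrPdist_le => e e0.
  have : M * q ^+ n * d @[n --> \oo] --> M * 0 * d.
    by apply: cvgMr_tmp; apply: cvgMl_tmp; apply: cvg_expr; rewrite ger0_norm.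
  rewrite mulr0 mul0r => /cvgr_le /(_ e e0); apply: filterS => n /= Mn.
  exact: le_trans (uM n) Mn.
have acv := cv0 _ _ xa.
have bcv := cv0 _ (fun n => b n.+1) xb.
have bx : ball x rho xhat.
  rewrite -ball_normE /=; apply: le_lt_trans xx _; apply: lt_le_trans a0x _.
  by apply: le_trans r_half _; rewrite ler_pdivrMr// ler_peMr ?ltW// ltr1n.
exists xhat; split=> //; last first.
- by rewrite distrC.
- by rewrite -(cvg_shiftS b).
- split.
    apply: closed_rel_lim clA _ bx _ acv; first exact: ball_open.
    by move=> n; have [] := inv n.
  apply: closed_rel_lim clB _ bx _ bcv; first exact: ball_open.
  by move=> n; have [[]] := steps n.
Qed.

End Iteration.

Unset Implicit Arguments.

Theorem theorem6p6 (R : realType) (H : euclideanType R) (A B : set H)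
    (xbar : H) (cbar : R)
    (A_neq0 : A !=set0) (B_neq0 : B !=set0)
    (Axbar : A xbar) (Bxbar : B xbar)
    (A_lc : locally_closed A xbar) (B_lc : locally_closed B xbar)
    (AB_transversal : intersect_transversally A B xbar)
    (cbarE : cos_angle A B xbar = cbar) (cbar_lt1 : cbar < 1)
    (A_sr : super_regular A xbar) (B_sr : super_regular B xbar)
    (c sigmaA sigmaB : R)
    (cbar_lt_c : cbar < c) (c_lt1 : c < 1)
    (sigmaA_gt1 : 1 < sigmaA) (sigmaA_lt : sigmaA < 1 / c)
    (sigmaB_gt1 : 1 < sigmaB) (sigmaB_lt : sigmaB < 1 / c) :
  let kappaA := sigmaA / sigmaB *
    (c + Num.sqrt (1 - c ^+ 2) * Num.sqrt (sigmaB ^+ 2 - 1)) in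
  let kappaB := sigmaB / sigmaA *
    (c + Num.sqrt (1 - c ^+ 2) * Num.sqrt (sigmaA ^+ 2 - 1)) in
  kappaA * kappaB < 1 ->
  exists delta : R, 0 < delta /\
    forall a0 : H, A a0 ->
    `|a0 - xbar| < (1 - kappaA * kappaB) /
      (2 * (sigmaB + 1) * (sigmaB + 1 + kappaA * (sigmaB - kappaB))) * delta ->
    qap_well_defined A B sigmaA sigmaB a0 /\
    forall a b : nat -> H, qap A B sigmaA sigmaB a0 a b ->
    exists xhat : H,
      [/\ (A `&` B) xhat, a @ \oo --> xhat, b @ \oo --> xhat,
          `|xhat - xbar| < 3 / 8 * delta &
          forall n : nat,
            `|xhat - a n| <= sigmaB * (1 + kappaA) / (1 - kappaA * kappaB) *
                             (kappaA * kappaB) ^+ n * dist a0 B /\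
            `|xhat - b n.+1| <= sigmaB * (1 + kappaB) * kappaA /
                             (1 - kappaA * kappaB) *
                             (kappaA * kappaB) ^+ n * dist a0 B].
Proof.
move=> kA kB kAB1.
have cos0 : 0 <= cbar by rewrite -cbarE; exact: cos_angle_ge0.
have c0 : 0 < c := le_lt_trans cos0 cbar_lt_c.
have inv s : 1 < s -> s < 1 / c -> c < s^-1.
  move=> s1; have s0 : 0 < s by apply: lt_trans s1.
  by rewrite -[s^-1]div1r !ltr_pdivlMr// mulrC.
have csA := inv _ sigmaA_gt1 sigmaA_lt; have csB := inv _ sigmaB_gt1 sigmaB_lt.
have sA1 := ltW sigmaA_gt1; have sB1 := ltW sigmaB_gt1.
have sA0 : 0 < sigmaA by apply: lt_trans sigmaA_gt1.
have sB0 : 0 < sigmaB by apply: lt_trans sigmaB_gt1.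
have [c1 /andP[cosc1 c1c]] : exists c1, cbar < c1 < c.
  by exists ((cbar + c) / 2); rewrite !midf_lt.
have c10 : 0 <= c1 by exact: le_trans (ltW cosc1).
have [r1 r10 ang] : exists2 rho, 0 < rho & angle_on A B xbar rho c1.
  by apply: cos_angle_near; rewrite cbarE.
have [rB rB0 nearB] :=
  contracts_near Axbar Bxbar A_sr B_sr r10 ang c10 c1c sB1 csB.
have [rA rA0 nearA] :=
  contracts_near Bxbar Axbar B_sr A_sr r10 (angle_onC ang) c10 c1c sA1 csA.
pose delta := Num.min rA rB.
have delta0 : 0 < delta by rewrite lt_min rA0.
have [dA dB] : delta <= rA /\ delta <= rB by rewrite !ge_min !lexx orbT.
have [clA clB ctAB] : [/\ _, _ & _] := nearB delta dB.
have [_ _ ctBA] : [/\ _, _ & _] := nearA delta dA.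
have m0 s : 0 < s -> 0 <= s * cos_acosB c s^-1.
  move=> s0; apply: mulr_ge0; first exact: ltW.
  by apply: cos_acosB_ge0; rewrite ?invr_ge0 ltW.
have mA0 := m0 _ sA0; have mB0 := m0 _ sB0.
move: ctAB ctBA mA0 mB0.
set mB := sigmaB * cos_acosB c _; set mA := sigmaA * cos_acosB c _.
move=> ctAB ctBA mA0 mB0.
have kAE : kA = sigmaA / sigmaB * mB by rewrite /mB sigma_cos_acosBE.
have kBE : kB = sigmaB / sigmaA * mA by rewrite /mA sigma_cos_acosBE.
have qE : kA * kB = mA * mB by rewrite kAE kBE; field; rewrite !gt_eqF.
have lE : sigmaB * (1 + kA) = sigmaB + sigmaA * mB.
  by rewrite kAE; field; rewrite gt_eqF.
exists delta; split=> // a0 Aa0 a0x.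
have q1 : mA * mB < 1 by rewrite -qE.
have q10 : 0 < 1 - mA * mB by rewrite subr_gt0.
have sB10 : 0 < sigmaB + 1 by rewrite addr_gt0.
set K := (sigmaB + sigmaA * mB) / (1 - mA * mB).
have near0 : `|a0 - xbar| + K * dist a0 B < delta / (2 * (sigmaB + 1)).
  have K0 : 0 <= K.
    apply: divr_ge0; last by rewrite subr_ge0 ltW.
    by apply: addr_ge0; [exact: ltW | apply: mulr_ge0 => //; exact: ltW].
  have da : dist a0 B <= `|a0 - xbar| by exact: dist_le.
  apply: (@le_lt_trans _ _ ((1 + K) * `|a0 - xbar|)).
    by rewrite mulrDl mul1r lerD2l ler_wpM2l.
  have K1 : 0 < 1 + K by rewrite ltr_wpDr.
  move: a0x; rewrite -(ltr_pM2l K1) => /lt_le_trans; apply.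
  (* The radius allowed for [a0] is delta / (2 (sigmaB + 1)) divided by 1 + K. *)
  have -> : sigmaB + 1 + kA * (sigmaB - kB) = (1 + K) * (1 - mA * mB).
    rewrite /K mulrDl divfK ?subr_eq0 1?eq_sym ?lt_eqF// -lE -qE; ring.
  by rewrite qE; apply: le_of_eq; field; rewrite !gt_eqF.
split.
  exact: qap_exists Axbar Bxbar delta0 sA1 sB1 mA0 mB0 clA clB ctAB ctBA q1
    Aa0 near0.
move=> a b ab.
have [xhat [xAB ax bx xx bd]] :=
  qap_cvg Bxbar delta0 sA1 sB1 mA0 mB0 clA clB ctAB ctBA q1 Aa0 near0 ab.
exists xhat; split=> //.
  (* As sigmaB + 1 > 2, the limit even lies within delta / 4 of xbar. *)
  apply: le_lt_trans xx _; apply: lt_trans near0 _.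
  rewrite ltr_pdivrMr ?mulr_gt0 ?ltr_wpDl 1?ltW//; nra.
move=> n; have [h1 h2] := bd n; rewrite qE lE; split=> //.
have -> // : sigmaB * (1 + kB) * kA / (1 - mA * mB) = sigmaA * mB + K * (mA * mB).
rewrite /K kAE kBE; field; rewrite !gt_eqF// subr_gt0//.
Qed.
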